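(* Let $A:\mathbb{R}\to\mathbb{R}^{n\times n}$ be continuous and bounded, and suppose the linear system $x'=A(t)x$ admits an algebraic dichotomy with respect to a growth rate $\mu$, with projections $P(s)$, $Q(s)=I-P(s)$ and constants $K>0$, $\alpha>0$. Let $f:\mathbb{R}\times\mathbb{R}^n\to\mathbb{R}^n$ be continuous and suppose there are constants $\beta,\gamma\ge 0$ such that for all $t\in\mathbb{R}$ and $x,x_1,x_2\in\mathbb{R}^n$, $$\|f(t,x)\|\le \beta\,\mu'(t)\mu^{-1}(t),\qquad \|f(t,x_1)-f(t,x_2)\|\le \gamma\,\mu'(t)\mu^{-1}(t)\,\|x_1-x_2\|,$$ and $6K\gamma\alpha^{-1}<1$. Then the nonlinear system $x'=A(t)x+f(t,x)$ is topologically conjugated to the linear system $x'=A(t)x$; that is, there is a map $H:\mathbb{R}\times\mathbb{R}^n\to\mathbb{R}^n$ such that: (i) for each fixed $t$, $H(t,\cdot)$ is a homeomorphism of $\mathbb{R}^n$ onto $\mathbb{R}^n$; (ii) $\|H(t,x)-x\|\le 2K\beta\alpha^{-1}$ for all $t\in\mathbb{R}$, $x\in\mathbb{R}^n$; (iii) $G(t,\cdot):=H^{-1}(t,\cdot)$ satisfies $\|G(t,y)-y\|\le 2K\beta\alpha^{-1}$ for all $t\in\mathbb{R}$, $y\in\mathbb{R}^n$; (iv) if $x(t)$ is a solution of $x'=A(t)x+f(t,x)$ then $H(t,x(t))$ is a solution of $x'=A(t)x$, and if $y(t)$ is a solution of $x'=A(t)x$ then $G(t,y(t))$ is a solution of 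$x'=A(t)x+f(t,x)$.
   Context: $\|\cdot\|$ is a norm on $\mathbb{R}^n$ and also the induced operator norm. $T(t,s)$ denotes the evolution operator of $x'=A(t)x$, i.e. $T(t,s)x(s)=x(t)$ for every solution $x$. A growth rate is an increasing, differentiable function $\mu:\mathbb{R}\to(0,\infty)$ with $\mu(0)=1$, $\lim_{t\to-\infty}\mu(t)=0$ and $\lim_{t\to+\infty}\mu(t)=+\infty$. The system $x'=A(t)x$ admits an algebraic dichotomy (with respect to $\mu$) if there are projections $P(s)$, $s\in\mathbb{R}$, with $Q(s)=I-P(s)$, and constants $K>0,\alpha>0$ such that $T(t,s)P(s)=P(t)T(t,s)$ for all $t,s$, $\|T(t,s)P(s)\|\le K(\mu(t)/\mu(s))^{-\alpha}$ for $t\ge s$, and $\|T(t,s)Q(s)\|\le K(\mu(s)/\mu(t))^{-\alpha}$ for $t\le s$. *)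

(* Defs.v *)
From mathcomp Require Import all_boot all_order all_algebra.
From mathcomp Require Import all_classical all_reals all_analysis.
Set Implicit Arguments. Unset Strict Implicit. Unset Printing Implicit Defensive.
Import Order.TTheory GRing.Theory Num.Theory.
Import numFieldNormedType.Exports.
Local Open Scope classical_set_scope.
Local Open Scope ring_scope.

Definition is_norm (R : realType) (n : nat) (N : 'cV[R]_n -> R) : Prop :=
  [/\ forall x, N x = 0 -> x = 0,
      forall (a : R) x, N (a *: x) = `|a| * N x
    & forall x y, N (x + y) <= N x + N y].

(* "the operator norm of M induced by N is at most c":
   ||M|| = sup_{x<>0} N(Mx)/N(x) <= c, written out. *)
Definition opnorm_le (R : realType) (n : nat) (N : 'cV[R]_n -> R)
  (M : 'M[R]_n) (c : R) : Prop :=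
  forall x, N (M *m x) <= c * N x.

Definition is_solution (R : realType) (n : nat)
  (F : R -> 'cV[R]_n -> 'cV[R]_n) (x : R -> 'cV[R]_n) : Prop :=
  forall t, derivable x t 1 /\ derive1 x t = F t (x t).

Definition growth_rate (R : realType) (mu : R -> R) : Prop :=
  [/\ {homo mu : s t / s < t},
      (forall t, derivable mu t 1),
      (forall t, 0 < mu t),
      mu 0 = 1
    & (mu x @[x --> -oo] --> 0) /\ (mu x @[x --> +oo] --> +oo)].

Definition evolution_operator (R : realType) (n : nat) (A : R -> 'M[R]_n)
  (T : R -> R -> 'M[R]_n) : Prop :=
  forall x, is_solution (fun t v => A t *m v) x ->
    forall t s, T t s *m x s = x t.

Definition algebraic_dichotomy (R : realType) (n : nat) (N : 'cV[R]_n -> R)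
  (T : R -> R -> 'M[R]_n) (mu : R -> R) (P : R -> 'M[R]_n) (K alpha : R) : Prop :=
  [/\ 0 < K /\ 0 < alpha,
      (forall s, P s *m P s = P s),
      (forall t s, T t s *m P s = P t *m T t s),
      (forall t s, s <= t ->
         opnorm_le N (T t s *m P s) (K * powR (mu t / mu s) (- alpha)))
    & (forall t s, t <= s ->
         opnorm_le N (T t s *m (1%:M - P s)) (K * powR (mu s / mu t) (- alpha)))].

(* Main.v *)
Require Import Defs.
From mathcomp Require Import all_boot all_order all_algebra.
From mathcomp Require Import all_classical all_reals all_analysis.
From mathcomp Require Import ring lra.
Import Order.TTheory GRing.Theory Num.Theory.
Import numFieldNormedType.Exports.
Local Open Scope classical_set_scope.
Local Open Scope ring_scope.
Set Implicit Arguments. Unset Strict Implicit. Unset Printing Implicit Defensive.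

(** Two solutions, [x] of the nonlinear and [y] of the linear system, are
    partners when [x - y] is bounded.  The dichotomy makes the linear system
    have no bounded solution but [0] and makes every [z' = A z + g] with
    [N (g t) <= b mu'/mu] have a unique bounded solution, of norm at most
    [2 K b / alpha].  Hence each [x] has exactly one linear partner (take
    [g = - f(t, x)]), each [y] has exactly one nonlinear partner (a fixed point
    of a contraction of ratio [2 K gamma / alpha]), and [H t], [G t] map the
    value at [t] of a solution to the value at [t] of its partner.  Their common
    graph is [{(xi, eta) | forall s, N (X_s xi - Y_s eta) <= 2 K beta / alpha}],
    [X] and [Y] being the flows; it is closed and lies at bounded distance from
    the diagonal, which gives continuity by compactness of balls.

    The function [mu'] need not be continuous, so integrals of [mu'/mu] are
    avoided: the only integrals taken are primitives of continuous functions,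
    and all estimates come from the mean value inequality
    [N (w') <= phi' -> N (w b - w a) <= phi b - phi a], with [phi] built from
    [L = ln mu]. *)

(** * Norms on column vectors *)

Lemma trmx_continuous (R : realType) (m n : nat) :
  continuous (@trmx R m n).
Proof.
move=> M s /= /nbhs_ballP [e e0 es].
apply/nbhs_ballP; exists e => //= M' [_ MM']; apply: es; split=> // i j.
by rewrite !mxE; exact: MM'.
Qed.

Lemma normr_coord_le (R : realType) (m n : nat) (x : 'M[R]_(m, n)) i j :
  `|x i j| <= `|x|.
Proof.
rewrite [leRHS]/Num.norm /= mx_normrE.
exact: (le_bigmax _ (fun ij => `|x ij.1 ij.2|) (i, j)).
Qed.

(** The library norm is the largest absolute entry, so the ball lies in the transpose of a cube of
    row vectors, which is compact as a product of segments. *)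
Lemma closed_ball_cV_compact (R : realType) (n : nat) (M : R) :
  compact [set v : 'cV[R]_n | `|v| <= M].
Proof.
have cM : compact [set v : 'rV[R]_n | forall i, v ord0 i \in `[(- M), M]].
  apply: (@rV_compact _ _ (fun=> `[(- M), M]%classic)).
  by move=> _; exact: segment_compact.
have := @continuous_compact _ _ (@trmx R 1 n) _
  (continuous_subspaceT (@trmx_continuous R 1 n)) cM.
move=> cM'; apply: (subclosed_compact _ cM').
  have -> : [set v : 'cV[R]_n | `|v| <= M] = Num.norm @^-1` [set y | y <= M] by [].
  apply: closed_comp; last exact: closed_le.
  by move=> x _; exact: norm_continuous.
move=> v /= vM; exists v^T; last by rewrite trmxK.
move=> i; rewrite mxE in_itv /= -ler_norml.
exact: le_trans (normr_coord_le _ _ _) vM.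
Qed.

Section Norm.
Variables (R : realType) (n : nat) (N : 'cV[R]_n -> R).
Hypothesis normN : is_norm N.
Implicit Types (x y v : 'cV[R]_n).

Lemma vnormZ (a : R) x : N (a *: x) = `|a| * N x.
Proof. by case: normN. Qed.

Lemma vnormD x y : N (x + y) <= N x + N y.
Proof. by case: normN. Qed.

Lemma vnorm_eq0 x : N x = 0 -> x = 0.
Proof. by case: normN => + _ _; apply. Qed.

Lemma vnorm0 : N 0 = 0.
Proof. by rewrite -(scale0r 0) vnormZ normr0 mul0r. Qed.

Lemma vnormN x : N (- x) = N x.
Proof. by rewrite -scaleN1r vnormZ normrN normr1 mul1r. Qed.

Lemma vnormC x y : N (x - y) = N (y - x).
Proof. by rewrite -vnormN opprB. Qed.

Lemma vnormB x y : N (x - y) <= N x + N y.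
Proof. by rewrite (le_trans (vnormD _ _))// vnormN. Qed.

Lemma vnorm_ge0 x : 0 <= N x.
Proof. by have := vnormB x x; rewrite subrr vnorm0 -mulr2n pmulrn_lge0. Qed.

Lemma vnorm_tri y x z : N (x - z) <= N (x - y) + N (y - z).
Proof. by rewrite -(subrKA y); exact: vnormD. Qed.

Lemma vnorm_sum (I : Type) (r : seq I) (F : I -> 'cV[R]_n) :
  N (\sum_(i <- r) F i) <= \sum_(i <- r) N (F i).
Proof.
elim/big_ind2 : _ => [|x a y b xa yb|//]; first by rewrite vnorm0.
by rewrite (le_trans (vnormD _ _))// lerD.
Qed.

Lemma vnorm_small_eq0 x : (forall e, 0 < e -> N x <= e) -> x = 0.
Proof.
move=> h; apply: vnorm_eq0; apply/eqP; rewrite eq_le vnorm_ge0 andbT.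
by apply/ler_addgt0Pl => e e0; rewrite addr0 h.
Qed.

(** Expansion in the standard basis gives this half of the equivalence of norms. The summand [1]
    keeps the constant positive even when [n = 0]. *)
Lemma vnorm_le_normr : exists2 c, 0 < c & forall x, N x <= c * `|x|.
Proof.
exists (1 + \sum_(i < n) N (delta_mx i 0)).
  by rewrite ltr_pwDl// sumr_ge0// => i _; exact: vnorm_ge0.
move=> x; rewrite {1}[x]matrix_sum_delta.
under eq_bigr do rewrite big_ord1.
rewrite (le_trans (vnorm_sum _ _))// mulrDl mul1r mulr_suml.
rewrite -[leLHS]add0r lerD// ler_sum// => i _.
by rewrite vnormZ mulrC ler_wpM2l ?vnorm_ge0// normr_coord_le.
Qed.

Lemma vnorm_continuous : continuous N.
Proof.
have [c c0 Nc] := vnorm_le_normr.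
move=> x; apply: (@cvgrPdist_le _ _ _ (nbhs x) _ N (N x)).2 => e e0.
have := @cvgrPdist_le _ _ _ (nbhs x) _ id x; case=> + _ => /(_ cvg_id _ (divr_gt0 e0 c0)).
apply: filterS => y; rewrite ler_pdivlMr// mulrC => xy.
apply: le_trans xy; apply: le_trans (Nc _).
have := vnormD (x - y) y; have := vnormD (y - x) x; rewrite !subrK (vnormC y x).
by move=> yx xy'; rewrite ler_norml; apply/andP; split; lra.
Qed.

(** The other half of the equivalence: the continuous [N] attains a minimum on the compact unit
    sphere of the library norm, and this minimum is positive by definiteness. *)
Lemma normr_le_vnorm : exists2 c, 0 < c & forall x, `|x| <= c * N x.
Proof.
pose S := [set v : 'cV[R]_n | `|v| = 1].
have cS : compact S.
  apply: subclosed_compact (@closed_ball_cV_compact R n 1) _; last first.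
    by move=> v /= ->.
  have -> : S = Num.norm @^-1` [set 1] by [].
  by apply: closed_comp; [move=> x _; exact: norm_continuous|exact: closed_eq].
(* If the sphere is empty, then every vector is [0] and any positive constant serves. *)
have [S0|/set0P/negP/negPn/eqP S0] := pselect (S !=set0); last first.
  exists 1 => // x; have [->|x0] := eqVneq x 0; first by rewrite normr0 mul1r vnorm_ge0.
  suff : S (`|x|^-1 *: x) by rewrite S0.
  by rewrite /S /= normrZ normfV normr_id mulVf// normr_eq0.
have [v Sv Nv] := compact_EVT_min S0 cS (continuous_subspaceT vnorm_continuous).
rewrite inE in Sv.
have v0 : 0 < N v.
  rewrite lt_def vnorm_ge0 andbT; apply/eqP => /vnorm_eq0 v0.
  by move: Sv; rewrite /S /= v0 normr0 => /eqP; rewrite eq_sym oner_eq0.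
exists (N v)^-1; first by rewrite invr_gt0.
move=> x; rewrite mulrC ler_pdivlMr//.
have [->|x0] := eqVneq x 0; first by rewrite normr0 mul0r vnorm_ge0.
have x1 : 0 < `|x| by rewrite normr_gt0.
have := Nv (`|x|^-1 *: x); rewrite inE /S /= normrZ normfV normr_id mulVf ?gt_eqF//.
by move=> /(_ erefl); rewrite vnormZ normfV normr_id mulrC ler_pdivlMr// mulrC.
Qed.

(** By the equivalence of norms, limits can be handled with [N] alone, without carrying constants
    along. *)
Lemma vnorm_cvgP (T : Type) (F : set_system T) (FF : Filter F)
    (u : T -> 'cV[R]_n) (l : 'cV[R]_n) :
  u @ F --> l <-> forall e, 0 < e -> \forall t \near F, N (l - u t) <= e.
Proof.
split=> [/cvgrPdist_le ul e e0|ul].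
  have [c c0 Nc] := vnorm_le_normr.
  apply: filterS (ul _ (divr_gt0 e0 c0)) => t.
  by rewrite ler_pdivlMr// mulrC; exact: le_trans.
have [c c0 Nc] := normr_le_vnorm.
apply/cvgrPdist_le => e e0; apply: filterS (ul _ (divr_gt0 e0 c0)) => t.
by rewrite ler_pdivlMr// mulrC; exact: le_trans.
Qed.

End Norm.

(** * Derivatives, primitives and the mean value inequality *)

Lemma is_derive1P (R : realType) (W : normedModType R) (w : R -> W) (t : R) (v : W) :
  is_derive t 1 w v <-> derivable w t 1 /\ derive1 w t = v.
Proof.
by rewrite derive1E; split=> [[]//|[? ?]]; exact: DeriveDef.
Qed.

Lemma is_derive1_cont (R : realType) (W : normedModType R) (w dw : R -> W) :
  (forall t : R, is_derive t 1 w (dw t)) -> continuous w.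
Proof.
move=> dwt t; apply: differentiable_continuous.
by apply/derivable1_diffP; exact: ex_derive.
Qed.

Lemma is_derive_littleo (R : realType) (W : normedModType R) (w : R -> W) (t : R) (dw : W) :
  is_derive t 1 w dw -> forall e, 0 < e ->
  \forall s \near t, `|w s - w t - (s - t) *: dw| <= e * `|s - t|.
Proof.
move=> [/derivable_nbhs wt <-] e e0.
move: wt => /eqaddoP /(_ e e0); rewrite [X in _ -> X](near_shift 0).
apply: filterS => h /=; rewrite subr0 addrK opprD addrA => wh.
have -> : w (h + t) = w (h *: (1 : R) + t) by rewrite [h *: _]mulr1.
exact: wh.
Qed.

Lemma is_derive_mx (R : realType) (m n : nat) (M : R -> 'M[R]_(m, n)) (t : R) dM :
  is_derive t 1 M dM <->
  forall i j, is_derive t 1 (fun s => M s i j) (dM i j).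
Proof.
split=> [[Mt <-] i j|Mt].
  rewrite derive_mx// mxE; apply: derivableP.
  exact: (derivable_mxP _ _ _).1.
have dMt : derivable M t 1.
  by apply/derivable_mxP => i j; exact: ex_derive.
apply: DeriveDef => //; rewrite derive_mx//; apply/matrixP => i j; rewrite mxE.
exact: derive_val.
Qed.

Lemma is_derive_mulmx (R : realType) (m n p : nat) (X : R -> 'M[R]_(m, n))
    (v : R -> 'M[R]_(n, p)) (t : R) dX dv :
  is_derive t 1 X dX -> is_derive t 1 v dv ->
  is_derive t 1 (fun s => X s *m v s) (dX *m v t + X t *m dv).
Proof.
move=> /is_derive_mx Xt /is_derive_mx vt; apply/is_derive_mx => i j.
have -> : (fun s => (X s *m v s) i j) =
    \sum_k ((fun s => X s i k) * (fun s => v s k j)).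
  by apply/funext => s; rewrite mxE fct_sumE.
apply: is_derive_eq.
rewrite !mxE -big_split /=; apply: eq_bigr => k _.
by rewrite addrC; congr (_ + _); exact: mulrC.
Qed.

Lemma is_derive_mulmxl (R : realType) (m n p : nat) (M : 'M[R]_(m, n))
    (v : R -> 'M[R]_(n, p)) (t : R) dv :
  is_derive t 1 v dv -> is_derive t 1 (fun s => M *m v s) (M *m dv).
Proof.
move=> vt; have := is_derive_mulmx (is_derive_cst M t 1) vt.
by rewrite mul0mx add0r.
Qed.

Lemma continuous_mxP (R : realType) (T : topologicalType) (m n : nat)
    (M : T -> 'M[R]_(m, n)) :
  continuous M <-> forall i j, continuous (fun s => M s i j).
Proof.
split=> [cM i j t|cM t].
  by apply: (@continuous_comp _ _ _ M (fun M : 'M[R]_(m, n) => M i j));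
    [exact: cM|exact: coord_continuous].
apply/cvgrPdist_le => /= e e0; near=> x.
rewrite /Num.norm/= mx_normrE (bigmax_le _ (ltW e0))//= => i _.
rewrite !mxE/=.
move: i; near: x; apply: filter_forall => /= i.
by have /cvgrPdist_le := cM i.1 i.2 t; exact.
Unshelve. all: by end_near. Qed.

Lemma continuous_mulmx (R : realType) (T : topologicalType) (m n p : nat)
    (X : T -> 'M[R]_(m, n)) (v : T -> 'M[R]_(n, p)) :
  continuous X -> continuous v -> continuous (fun s => X s *m v s).
Proof.
move=> /continuous_mxP cX /continuous_mxP cv; apply/continuous_mxP => i j.
have -> : (fun s => (X s *m v s) i j) = (fun s => \sum_k X s i k * v s k j).
  by apply/funext => s; rewrite mxE.
apply: continuous_big => [|k _ t]; first exact: add_continuous.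
by apply: cvgM; [exact: cX|exact: cv].
Qed.

(** * Primitives of continuous functions *)

Lemma continuous_itv_integrable (R : realType) (g : R -> R) (a b : R) :
  continuous g ->
  (@lebesgue_measure R).-integrable `[a, b] (EFin \o g).
Proof.
move=> cg; apply: continuous_compact_integrable; first exact: segment_compact.
exact: continuous_subspaceT.
Qed.

Lemma Rintegral_itv_base (R : realType) (g : R -> R) (a b c : R) :
  continuous g -> a <= b -> b <= c ->
  \int[@lebesgue_measure R]_(s in `[a, c]) g s =
  \int[@lebesgue_measure R]_(s in `[a, b]) g s +
  \int[@lebesgue_measure R]_(s in `[b, c]) g s.
Proof.
move=> cg ab bc.
have := @Rintegral_itvB R g (BLeft a) (BRight c) b
  (continuous_itv_integrable _ _ cg).
rewrite !bnd_simp => /(_ ab bc) /eqP; rewrite subr_eq addrC => /eqP ->.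
congr (_ + _); rewrite Rintegral_itv_obnd_cbnd//.
apply: integrableS (continuous_itv_integrable b c cg) => //.
by apply: subset_itvr; rewrite bnd_simp.
Qed.

Lemma continuous_primitive (R : realType) (g : R -> R) :
  continuous g -> exists G : R -> R, forall t : R, is_derive t 1 G (g t).
Proof.
(* The lower endpoint [- |t| - 1] lies to the left of both [0] and [t], so [G t] is the oriented
   integral from [0] to [t] without a case on the sign of [t]. *)
move=> cg; pose I a b := \int[@lebesgue_measure R]_(s in `[a, b]) g s.
pose G t := I (- `|t| - 1) t - I (- `|t| - 1) 0.
exists G => t.
(* For [s] within [1] of [t], the moving endpoint [- |s| - 1] stays to the right of [a]. Near [t],
   [G] therefore agrees with the primitive based at [a] up to a constant. *)
pose a := - `|t| - 2.
have -> : g t = g t - 0 by rewrite subr0.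
apply: (@near_eq_is_derive _ _ _ ((fun s => I a s) - cst (I a 0))); last first.
  apply: is_deriveB; apply/is_derive1P.
  apply: (@continuous_FTC1_closed _ _ _ _ (t + 1)); first by rewrite ltrDl.
  - exact: continuous_itv_integrable.
  - by rewrite /a; have := ler_norm (- t); rewrite normrN; lra.
  - exact: cg.
near=> s.
rewrite /G -[LHS]/(I a s - I a 0).
have ts : `|t - s| <= 1.
  by near: s; have /cvgrPdist_le := @cvg_id _ (nbhs t); exact.
have st : `|s| <= `|t| + 1.
  by have := ler_normB t (t - s); rewrite subKr; lra.
have as_ : a <= - `|s| - 1 by rewrite /a; lra.
have ss : - `|s| - 1 <= s by have := ler_norm (- s); rewrite normrN; lra.
have s0 : - `|s| - 1 <= 0 by have := normr_ge0 s; lra.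
rewrite [I a s](Rintegral_itv_base cg as_ ss) [I a 0](Rintegral_itv_base cg as_ s0).
by rewrite opprD addrACA subrr add0r.
Unshelve. all: by end_near. Qed.

Lemma continuous_primitive_mx (R : realType) (m n : nat) (g : R -> 'M[R]_(m, n)) :
  continuous g -> exists G : R -> 'M[R]_(m, n), forall t : R, is_derive t 1 G (g t).
Proof.
move=> /continuous_mxP cg.
have /choice[G Gg] : forall ij : 'I_m * 'I_n, exists G : R -> R,
    forall t : R, is_derive t 1 G (g t ij.1 ij.2).
  by move=> [i j]; exact: continuous_primitive.
exists (fun t => \matrix_(i, j) G (i, j) t) => t; apply/is_derive_mx => i j.
have -> : (fun s => (\matrix_(i, j) G (i, j) s) i j) = G (i, j).
  by apply/funext => s; rewrite mxE.
exact: Gg.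
Qed.

(** * The mean value inequality *)

Section MeanValue.
Variables (R : realType) (n : nat) (N : 'cV[R]_n -> R).
Hypothesis normN : is_norm N.

Lemma is_derive_vnorm (w : R -> 'cV[R]_n) (t : R) dw :
  is_derive t 1 w dw -> forall e, 0 < e ->
  \forall s \near t, N (w s - w t - (s - t) *: dw) <= e * `|s - t|.
Proof.
move=> wt e e0; have [c c0 Nc] := vnorm_le_normr normN.
apply: filterS (is_derive_littleo wt (divr_gt0 e0 c0)) => s.
rewrite mulrAC ler_pdivlMr// mulrC; exact: le_trans.
Qed.

(** Differentiability at one point yields the inequality with slack [e], half of it spent on [w] and
    half on [phi]. Both sides of [c] matter: the left one to reach a supremum, the right one to pass
    beyond it. *)
Lemma mean_value_local (w : R -> 'cV[R]_n) dw (phi : R -> R) (dphi c : R) :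
  is_derive c 1 w dw -> is_derive c 1 phi dphi -> N dw <= dphi ->
  forall e, 0 < e -> \forall s \near c,
  (c <= s -> N (w s - w c) <= phi s - phi c + e * (s - c)) /\
  (s <= c -> N (w c - w s) <= phi c - phi s + e * (c - s)).
Proof.
move=> wc phic dwphi e e0; have e2 : 0 < e / 2 by lra.
near=> s.
have h1 : N (w s - w c - (s - c) *: dw) <= e / 2 * `|s - c|.
  by near: s; exact: is_derive_vnorm.
have h2 : `|phi s - phi c - (s - c) * dphi| <= e / 2 * `|s - c|.
  by near: s; exact: (@is_derive_littleo _ R^o).
have h3 : N (w s - w c) <= e / 2 * `|s - c| + `|s - c| * dphi.
  rewrite -(subrK ((s - c) *: dw) (w s - w c)) (le_trans (vnormD normN _ _))//.
  by rewrite lerD// (vnormZ normN) ler_wpM2l.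
split=> sc.
  rewrite ger0_norm in h1 h2 h3; last by rewrite subr_ge0.
  by move: h2; rewrite ler_norml => /andP[h2 _]; lra.
rewrite ler0_norm in h1 h2 h3; last by rewrite subr_le0.
by rewrite (vnormC normN); move: h2; rewrite ler_norml => /andP[_ h2]; lra.
Unshelve. all: by end_near. Qed.

Lemma mean_value_ineq (w dw : R -> 'cV[R]_n) (phi dphi : R -> R) (a b : R) :
  a <= b ->
  (forall r : R, is_derive r 1 w (dw r)) ->
  (forall r : R, is_derive r 1 phi (dphi r)) ->
  (forall r, a <= r <= b -> N (dw r) <= dphi r) ->
  N (w b - w a) <= phi b - phi a.
Proof.
move=> ab wd phid le_d.
suff main e : 0 < e -> N (w b - w a) <= phi b - phi a + e * (b - a).
  apply/ler_addgt0Pr => e e0.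
  (* The [+ 1] keeps the denominator positive when [a = b]. *)
  have ba1 : 0 < b - a + 1 by lra.
  apply: le_trans (main (e / (b - a + 1)) _) _; first exact: divr_gt0.
  by rewrite lerD2l mulrAC ler_pdivrMr// ler_pM2l//; lra.
move=> e0.
(* The set S of points up to which the bound holds contains its supremum, and
   by differentiability S can be continued to the right of it. *)
pose S := [set t | a <= t <= b /\ N (w t - w a) <= phi t - phi a + e * (t - a)].
have Sa : S a by split; rewrite ?lexx ?ab// !subrr (vnorm0 normN) mulr0 addr0.
have supS : has_sup S.
  by split; [exists a|exists b => t [/andP[]]].
have Sle t : S t -> t <= sup S by move=> St; exact: sup_upper_bound.
pose c := sup S.
have ac : a <= c by exact: Sle.
have cb : c <= b by apply: sup_le_ub; [exists a|move=> t [/andP[]]].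
have acb : a <= c <= b by rewrite ac cb.
have [d /= d0 loc] := mean_value_local (wd c) (phid c) (le_d _ acb) e0.
have Sc : S c.
  split => //; have [t St ct] := sup_adherent d0 supS.
  have tc := Sle _ St; case: St => /andP[at_ tb] St.
  have [|_ /(_ tc)] := loc t.
    by rewrite /= ger0_norm ?subr_ge0// ltrBlDr -ltrBlDl.
  have := vnorm_tri normN (w t) (w c) (w a); rewrite -/c; lra.
have [bc|/(conj cb)/andP] := leP b c.
  have -> : b = c by apply/eqP; rewrite eq_le bc cb.
  by case: Sc.
move=> {}cb; exfalso; have {cb} cb : c < b by case: (leP b c) cb => // ? /andP[].
(* A point to the right of [c] where the local bound still applies; its membership in [S]
   contradicts the choice of [c] as supremum. *)
pose s := Num.min b (c + d / 2).
have cs : c < s by rewrite /s lt_min cb/= ltrDl; lra.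
have sb : s <= b by rewrite /s ge_min lexx.
have : S s.
  split; first by rewrite sb (le_trans ac (ltW cs)).
  have [|/(_ (ltW cs)) + _] := loc s.
    rewrite /= ler0_norm ?subr_le0 ?(ltW cs)//.
    have : s <= c + d / 2 by rewrite /s ge_min lexx orbT.
    lra.
  case: Sc => _ ; have := vnorm_tri normN (w c) (w s) (w a); lra.
by move=> /Sle; rewrite leNgt cs.
Qed.

End MeanValue.

(** * Weighted contractions and global solutions *)

Lemma expr_small (R : realType) (q : R) : 0 <= q < 1 ->
  forall B e, 0 < e -> exists k : nat, q ^+ k * B <= e.
Proof.
move=> /andP[q0 q1] B e e0.
have /cvgrPdist_le /(_ (e / (`|B| + 1))) : q ^+ k @[k --> \oo] --> 0.
  by apply: cvg_expr; rewrite ger0_norm.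
have B1 : 0 < `|B| + 1 by rewrite ltr_wpDl.
case=> [|k _ /(_ k (leqnn k))]; first exact: divr_gt0.
rewrite sub0r normrN ger0_norm ?exprn_ge0// ler_pdivlMr// => qk.
exists k; apply: le_trans qk; rewrite ler_wpM2l ?exprn_ge0//.
by rewrite (le_trans (ler_norm _))// lerDl.
Qed.

Section Picard.
Variables (R : realType) (n : nat) (N : 'cV[R]_n -> R).
Hypothesis normN : is_norm N.

(** Banach's fixed point argument for the distance given by the supremum of [N (u t - v t) / wt t],
    which may be infinite. The iterates from [u0] have summable increments, and they converge
    locally uniformly because [wt] is locally bounded. *)
Lemma weighted_contraction (Phi : (R -> 'cV[R]_n) -> R -> 'cV[R]_n)
    (wt : R -> R) (q C : R) (u0 : R -> 'cV[R]_n) :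
  continuous wt -> (forall t, 0 <= wt t) -> 0 <= q < 1 -> 0 <= C ->
  (forall u : R -> 'cV[R]_n, continuous u -> continuous (Phi u)) ->
  (forall (u v : R -> 'cV[R]_n) (D : R), continuous u -> continuous v -> 0 <= D ->
    (forall t, N (u t - v t) <= D * wt t) ->
    forall t, N (Phi u t - Phi v t) <= q * D * wt t) ->
  continuous u0 -> (forall t, N (Phi u0 t - u0 t) <= C * wt t) ->
  exists2 u, continuous u & forall t, Phi u t = u t.
Proof.
move=> cw w0 q01 C0 cPhi ctr cu0 Pu0; have /andP[q0 q1] := q01.
pose U k := iter k Phi u0.
have cU k : continuous (U k) by elim: k => //= k; exact: cPhi.
have dU k t : N (U k.+1 t - U k t) <= q ^+ k * C * wt t.
  elim: k t => [|k IH] t; first by rewrite expr0 mul1r; exact: Pu0.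
  by rewrite exprS -(mulrA q); apply: (ctr (U k.+1) (U k));
    [exact: cU|exact: cU|by rewrite mulr_ge0// exprn_ge0|exact: IH].
(* The sum of the geometric series of bounds in [dU]. *)
pose B t := C * wt t / (1 - q).
have q1' : 0 < 1 - q by rewrite subr_gt0.
have B0 t : 0 <= B t by rewrite /B divr_ge0 ?mulr_ge0// ltW.
(* Keeping the subtracted power [q ^+ (k + m)] makes the bound telescope under induction on [m]. *)
have UB k t m : N (U (k + m)%N t - U k t) <= (q ^+ k - q ^+ (k + m)) * B t.
  elim: m => [|m IH]; first by rewrite addn0 !subrr (vnorm0 normN) mul0r.
  rewrite (le_trans (vnorm_tri normN (U (k + m)%N t) _ _))//.
  have := dU (k + m)%N t; rewrite -addnS.
  have -> : q ^+ (k + m) * C * wt t = (q ^+ (k + m) - q ^+ (k + m.+1)) * B t.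
    rewrite addnS exprS /B; field; lra.
  by move: IH; lra.
have UB' k t m : N (U (k + m)%N t - U k t) <= q ^+ k * B t.
  by rewrite (le_trans (UB _ _ _))// ler_wpM2r// gerBl exprn_ge0.
have [c c0 cN] := normr_le_vnorm normN.
have cvU t : cvgn (fun k => U k t).
  apply: cauchy_cvg; apply: cauchy_exP => e e0.
  have [k qk] := expr_small q01 (B t) (divr_gt0 (divr_gt0 e0 c0) (ltr0Sn R 1)).
  exists (U k t); exists k => // m /= km.
  rewrite -ball_normE /ball_ /= (le_lt_trans (cN _))//.
  rewrite mulrC -ltr_pdivlMr// (vnormC normN) -(subnKC km).
  apply: le_lt_trans (UB' _ _ _) _; apply: le_lt_trans qk _.
  by have := divr_gt0 e0 c0; lra.
pose u t : 'cV[R]_n := lim (U k t @[k --> \oo]).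
have uU k t : N (u t - U k t) <= q ^+ k * B t.
  apply/ler_addgt0Pr => e e0.
  have /(vnorm_cvgP normN) /(_ _ e0) [m _ um] := cvU t.
  have /= um' := um (k + m)%N (leq_addl _ _).
  rewrite (le_trans (vnorm_tri normN (U (k + m)%N t) _ _))// addrC.
  by rewrite lerD.
have cu : continuous u.
  move=> t; apply/(vnorm_cvgP normN) => e e0.
  have e3 : 0 < e / 3 by lra.
  have [k qk] := expr_small q01 (C * (wt t + 1) / (1 - q)) e3.
  near=> s.
  have ws : wt s <= wt t + 1.
    have : `|wt t - wt s| <= 1.
      by near: s; have /cvgrPdist_le := cw t; exact.
    by rewrite ler_norml; lra.
  have Bk r : wt r <= wt t + 1 -> N (u r - U k r) <= e / 3.
    move=> wr; apply: le_trans (uU _ _) (le_trans _ qk).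
    rewrite ler_wpM2l ?exprn_ge0// /B ler_wpM2r ?invr_ge0 ?(ltW q1')//.
    by rewrite ler_wpM2l.
  have Ukts : N (U k t - U k s) <= e / 3.
    by near: s; have /(vnorm_cvgP normN) := cU k t; exact.
  have := Bk _ ws; have := Bk t; rewrite lerDl => /(_ ler01).
  have := vnorm_tri normN (U k t) (u t) (u s).
  have := vnorm_tri normN (U k s) (U k t) (u s).
  rewrite (vnormC normN (U k s) (u s)); lra.
exists u => // t; apply/eqP; rewrite -subr_eq0; apply/eqP.
apply: (vnorm_small_eq0 normN) => e e0.
have [k qk] := expr_small q01 (2 * B t) e0.
(* Both [Phi u] and [u] are within [q ^+ k.+1 * B t] of the iterate [U k.+1], so their distance is
   arbitrarily small. *)
have h1 : N (Phi u t - U k.+1 t) <= q * (q ^+ k * B t).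
  have := ctr u (U k) (q ^+ k * (C / (1 - q))) cu (cU k).
  have -> : q * (q ^+ k * B t) = q * (q ^+ k * (C / (1 - q))) * wt t.
    by rewrite /B; ring.
  apply; first by rewrite mulr_ge0 ?exprn_ge0// divr_ge0// ltW.
  move=> s; apply: le_trans (uU k s) _.
  by rewrite le_eqVlt; apply/orP; left; apply/eqP; rewrite /B; ring.
have h2 := uU k.+1 t; rewrite exprS -mulrA in h2.
have := vnorm_tri normN (U k.+1 t) (Phi u t) (u t).
rewrite (vnormC normN (U k.+1 t) (u t)).
have h0 : 0 <= q ^+ k * B t by rewrite mulr_ge0// exprn_ge0.
have h3 : q * (q ^+ k * B t) <= q ^+ k * B t by rewrite ler_piMl// ltW.
by move: h1 h2 h3 qk h0; lra.
Unshelve. all: by end_near. Qed.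

(** * Gronwall's inequality and global existence *)

Section Growth.
Variables (phi dphi : R -> R).
Hypothesis phiD : forall t : R, is_derive t 1 phi (dphi t).
Hypothesis dphi0 : forall t, 0 <= dphi t.

Lemma ge0_derive_ndecr s t : s <= t -> phi s <= phi t.
Proof.
move=> st; rewrite -subr_ge0.
have [st'|ts] := ltP s t; last first.
  by have -> : s = t by [apply/eqP; rewrite eq_le st ts]; rewrite subrr.
have [r _ ->] := MVT st' (fun r _ => phiD r)
  (continuous_subspaceT (is_derive1_cont phiD)).
by rewrite mulr_ge0// subr_ge0.
Qed.

(* In the norm weighted by expw, integrating against dphi halves norms; this
   turns the Picard operator into a contraction on the whole line although dphi
   may be locally unbounded. *)
Definition expw tau t := expR (2 * `|phi t - phi tau|).

Lemma expw_gt0 tau t : 0 < expw tau t.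
Proof. exact: expR_gt0. Qed.

Lemma expw_ge1 tau t : 1 <= expw tau t.
Proof. by rewrite -expR0 ler_expR mulr_ge0. Qed.

Lemma expw_continuous tau : continuous (expw tau).
Proof.
move=> t; apply: (@continuous_comp _ _ _ (fun t => 2 * `|phi t - phi tau|) expR);
  last exact: continuous_expR.
apply: cvgM; first exact: cvg_cst.
apply: cvg_norm; apply: cvgB; last exact: cvg_cst.
exact: is_derive1_cont phiD t.
Qed.

Lemma is_derive_expR_phi (a b k r : R) :
  is_derive r 1 (fun r => k * expR (a * phi r + b))
    (k * (a * dphi r * expR (a * phi r + b))).
Proof.
have h : is_derive r 1 (fun r => a * phi r + b) (a * dphi r).
  have := is_deriveD (is_deriveZ a (phiD r)) (is_derive_cst b r 1).
  by rewrite addr0.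
have h2 := @is_derive1_comp _ expR (fun r => a * phi r + b) r _ _
  (is_derive_expR (a * phi r + b)) h.
have := is_deriveZ k h2.
by rewrite -[X in is_derive _ _ _ X]/(k * (_ * _)) [_ * (a * _)]mulrC.
Qed.

(** As [phi] is nondecreasing, the absolute value in [expw] has a fixed sign on each side of [tau].
    There [D / 2 * expw tau], with a minus sign to the left of [tau], has derivative
    [D * dphi * expw tau], so the mean value inequality applies. *)
Lemma weighted_growth (w dw : R -> 'cV[R]_n) (D tau t : R) :
  0 <= D ->
  (forall r : R, is_derive r 1 w (dw r)) ->
  (forall r, Num.min tau t <= r <= Num.max tau t ->
    N (dw r) <= D * dphi r * expw tau r) ->
  N (w t - w tau) <= D / 2 * expw tau t.
Proof.
move=> D0 wD le_dw; have [tt|tt] := leP tau t.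
- rewrite (min_idPl tt) (max_idPr tt) in le_dw.
  have := mean_value_ineq normN tt wD
    (is_derive_expR_phi 2 (- (2 * phi tau)) (D / 2)).
  have E r : tau <= r ->
      D / 2 * expR (2 * phi r - 2 * phi tau) = D / 2 * expw tau r.
    move=> tr; rewrite /expw ger0_norm ?subr_ge0 ?ge0_derive_ndecr//.
    by rewrite mulrBr.
  have h : 0 <= D / 2 * expw tau tau.
    by rewrite mulr_ge0 ?divr_ge0// ltW// expw_gt0.
  rewrite (E t tt) (E tau (lexx _)) => h2.
  apply: (le_trans (h2 _)); last by rewrite gerBl.
  move=> r trt; apply: le_trans (le_dw r trt) _; case/andP: trt => tr _.
  have -> : D / 2 * (2 * dphi r * expR (2 * phi r - 2 * phi tau)) =
      2 * dphi r * (D / 2 * expR (2 * phi r - 2 * phi tau)) by ring.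
  by rewrite E//; lra.
- rewrite (min_idPr (ltW tt)) (max_idPl (ltW tt)) in le_dw.
  have := mean_value_ineq normN (ltW tt) wD
    (is_derive_expR_phi (- 2) (2 * phi tau) (- (D / 2))).
  have E r : r <= tau ->
      expR (- 2 * phi r + 2 * phi tau) = expw tau r.
    move=> tr; rewrite /expw ler0_norm ?subr_le0 ?ge0_derive_ndecr//.
    by congr expR; ring.
  have h : 0 <= D / 2 * expw tau tau.
    by rewrite mulr_ge0 ?divr_ge0// ltW// expw_gt0.
  rewrite (E t (ltW tt)) (E tau (lexx _)) (vnormC normN) => h2.
  apply: (le_trans (h2 _)); last by lra.
  move=> r trt; apply: le_trans (le_dw r trt) _; case/andP: trt => _ tr.
  by rewrite E//; lra.
Qed.

(** Let [m c] be the maximum of [N (d r) / expw tau r] between [tau] and [t]. Then [weighted_growth]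
    with [D = m c] bounds the change from [tau] to [c] by half of [N (d c)], hence
    [N (d c) <= 2 * N (d tau)]; this is the source of the factor [2]. *)
Lemma gronwall (d dd : R -> 'cV[R]_n) (tau t : R) :
  (forall r : R, is_derive r 1 d (dd r)) ->
  (forall r, N (dd r) <= dphi r * N (d r)) ->
  N (d t) <= 2 * expw tau t * N (d tau).
Proof.
move=> dD le_dd; pose m r := N (d r) / expw tau r.
pose a := Num.min tau t; pose b := Num.max tau t.
have ab : a <= b by rewrite /a /b ge_min le_max lexx.
have cm : continuous m.
  move=> r; apply: cvgM.
    apply: (@continuous_comp _ _ _ d N); first exact: (is_derive1_cont dD).
    exact: vnorm_continuous.
  by apply: cvgV; [rewrite gt_eqF// expw_gt0|exact: expw_continuous].
have [c cab mc] := EVT_max ab (continuous_subspaceT cm).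
have mE r : m r * expw tau r = N (d r).
  by rewrite /m divfK// gt_eqF// expw_gt0.
have m0 r : 0 <= m r by rewrite /m divr_ge0 ?vnorm_ge0// ltW// expw_gt0.
have tauab : tau \in `[a, b].
  by rewrite in_itv /= /a /b ge_min le_max !lexx.
have tab : t \in `[a, b].
  by rewrite in_itv /= /a /b ge_min le_max !lexx !orbT.
have h : N (d c - d tau) <= m c / 2 * expw tau c.
  apply: weighted_growth (m0 c) dD _ => r rc.
  have rab : r \in `[a, b].
    move: rc tauab cab; rewrite !in_itv /= => /andP[h1 h2] /andP[h3 h4] /andP[h5 h6].
    by rewrite (le_trans _ h1) ?(le_trans h2)// ?le_min ?ge_max ?h3 ?h5 ?h4 ?h6.
  apply: le_trans (le_dd r) _; rewrite [m c * _]mulrC -mulrA ler_wpM2l//.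
  by rewrite -mE ler_wpM2r ?mc// ltW// expw_gt0.
have {}h : m c * expw tau c <= 2 * N (d tau).
  have := vnormD normN (d c - d tau) (d tau); rewrite subrK -{1}mE; lra.
have {}h : m c <= 2 * N (d tau).
  by apply: le_trans h; rewrite ler_peMr// expw_ge1.
rewrite -(mE t) [leRHS]mulrAC; apply: ler_wpM2r; first exact/ltW/expw_gt0.
exact: le_trans (mc _ tab) h.
Qed.

(** The Picard operator is a contraction of ratio [1 / 2] in the norm weighted by [expw tau], so its
    fixed point is defined on the whole line at once, with no continuation of local solutions. *)
Lemma ode_exists (F : R -> 'cV[R]_n -> 'cV[R]_n) :
  (forall u : R -> 'cV[R]_n, continuous u -> continuous (fun t => F t (u t))) ->
  (forall t x y, N (F t x - F t y) <= dphi t * N (x - y)) ->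
  (forall t, N (F t 0) <= dphi t) ->
  forall tau xi, exists2 x, is_solution F x & x tau = xi.
Proof.
move=> cF lipF F0 tau xi.
(* A primitive is chosen for every [u]; for discontinuous [u] the value is a dummy. *)
have /choice[I Iu] : forall u : R -> 'cV[R]_n, exists G : R -> 'cV[R]_n,
    continuous u -> forall t : R, is_derive t 1 G (F t (u t)).
  move=> u; have [cu|ncu] := pselect (continuous u); last by exists u.
  by have [G GD] := continuous_primitive_mx (cF u cu); exists G.
pose Phi u t := xi + (I u t - I u tau).
have PhiD u : continuous u -> forall t : R, is_derive t 1 (Phi u) (F t (u t)).
  move=> cu t; have := is_deriveD (is_derive_cst xi t 1)
    (is_deriveB (Iu u cu t) (is_derive_cst (I u tau) t 1)).
  by rewrite add0r subr0.
have Phitau u : Phi u tau = xi by rewrite /Phi subrr addr0.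
have e0 t : 0 <= expw tau t by exact/ltW/expw_gt0.
(* The constant [(1 + N xi) / 2] comes from [N (F r xi) <= (1 + N xi) * dphi r], halved by
   [weighted_growth]. *)
have [||||||u cu Phiu] := @weighted_contraction Phi (expw tau) (1 / 2)
  ((1 + N xi) / 2) (cst xi) (@expw_continuous tau) e0.
- by apply/andP; split; lra.
- by rewrite divr_ge0// addr_ge0// (vnorm_ge0 normN).
- by move=> u cu; exact: is_derive1_cont (PhiD u cu).
- move=> u v D cu cv D0 uv t.
  have -> : Phi u t - Phi v t = (Phi u - Phi v) t - (Phi u - Phi v) tau.
    by rewrite -[(_ - _) t]/(_ - _) -[(_ - _) tau]/(_ - _) !Phitau subrr subr0.
  rewrite (_ : 1 / 2 * D = D / 2); last by lra.
  apply: weighted_growth => //.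
    by move=> r; apply: is_deriveB; exact: PhiD.
  move=> r _ /=; apply: le_trans (lipF _ _ _) _.
  by rewrite [D * _]mulrC -mulrA ler_wpM2l.
- by move=> t; exact: cvg_cst.
- move=> t; rewrite -[cst xi t](Phitau (cst xi)); apply: weighted_growth => //.
  + by rewrite addr_ge0// (vnorm_ge0 normN).
  + by move=> r; apply: PhiD => s; exact: cvg_cst.
  + move=> r _ /=; rewrite /cst.
    have := lipF r xi 0; have := vnormD normN (F r xi - F r 0) (F r 0).
    rewrite subrK subr0 => h1 h2; have := F0 r => h3.
    have h4 : (1 + N xi) * dphi r <= (1 + N xi) * dphi r * expw tau r.
      by rewrite ler_peMr ?expw_ge1// mulr_ge0// addr_ge0// (vnorm_ge0 normN).
    by apply: le_trans h4; lra.
exists (Phi u); last exact: Phitau.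
by move=> t; apply/is_derive1P; rewrite Phiu; exact: PhiD.
Qed.

End Growth.
End Picard.

(** * Linear systems with a dichotomy *)

Section Limits.
Variables (R : realType) (n : nat) (N : 'cV[R]_n -> R).
Hypothesis normN : is_norm N.

Lemma vnorm_cauchy_cvg (F : set_system R) (FF : ProperFilter F) (u : R -> 'cV[R]_n) :
  (forall e, 0 < e -> exists x, \forall s \near F, N (x - u s) <= e) ->
  exists c : 'cV[R]_n, u @ F --> c.
Proof.
move=> h; apply/cvg_ex; apply: cauchy_cvg; apply: cauchy_exP => e e0.
have [c c0 cN] := normr_le_vnorm normN.
have [|x xs] := h (e / c / 2); first by rewrite !divr_gt0.
exists x; apply: filterS xs => s xs.
rewrite -ball_normE /ball_ /= (le_lt_trans (cN _))// mulrC -ltr_pdivlMr//.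
by apply: le_lt_trans xs _; have := divr_gt0 e0 c0; lra.
Qed.

(** Serves to let an endpoint tend to infinity in the increment estimates for the variation of
    constants formula. *)
Lemma vnorm_mulmx_lim_le (F : set_system R) (FF : ProperFilter F)
    (u : R -> 'cV[R]_n) (c x : 'cV[R]_n) (M : 'M[R]_n) (D : R) :
  u @ F --> c -> (\forall s \near F, N (M *m (x - u s)) <= D) ->
  N (M *m (x - c)) <= D.
Proof.
move=> uc uD; apply/ler_addgt0Pr => e e0.
have cM : continuous (fun v : 'cV[R]_n => M *m v).
  apply: (@continuous_mulmx _ _ _ _ _ (cst M) id); first exact: cst_continuous.
  by move=> v.
have /(vnorm_cvgP normN) /(_ _ e0) Muc : (M *m u s) @[s --> F] --> M *m c.
  by apply: (cvg_comp u (fun v => M *m v) uc); exact: cM.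
have [s [h1 h2]] := @filter_ex _ F _ _ (filterI uD Muc).
rewrite mulmxBr; rewrite mulmxBr in h1.
rewrite (le_trans (vnorm_tri normN (M *m u s) _ _))// (vnormC normN (M *m u s)).
exact: lerD.
Qed.

End Limits.

(** * The evolution operator of a bounded linear system *)

Section Linear.
Variables (R : realType) (n : nat) (N : 'cV[R]_n -> R) (A : R -> 'M[R]_n).
Variables (T : R -> R -> 'M[R]_n) (M : R).
Hypothesis normN : is_norm N.
Hypothesis cA : continuous A.
Hypothesis M0 : 0 <= M.
Hypothesis AM : forall t, opnorm_le N (A t) M.
Hypothesis evT : evolution_operator A T.

Lemma is_derive_scale_id (t : R) : is_derive t 1 (fun t : R => M * t) M.
Proof.
have := is_deriveZ M (is_derive_id t 1).
by rewrite -[X in is_derive _ _ _ X]/(M * 1) mulr1.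
Qed.

Lemma linear_exists tau xi :
  exists2 x, is_solution (fun t v => A t *m v) x & x tau = xi.
Proof.
apply: (ode_exists normN is_derive_scale_id (fun=> M0)).
- by move=> u cu; exact: continuous_mulmx.
- by move=> t x y; rewrite -mulmxBr; exact: AM.
- by move=> t; rewrite mulmx0 (vnorm0 normN).
Qed.

(** The definition of [evolution_operator] constrains [T] only along existing solutions. Since a
    solution passes through every point, [T] is thereby determined, and its usual properties
    follow. *)
Lemma evolution_solution s v :
  is_solution (fun t v => A t *m v) (fun t => T t s *m v) /\ T s s *m v = v.
Proof.
have [x xs xv] := linear_exists s v.
have -> : (fun t => T t s *m v) = x by apply/funext => t; rewrite -xv evT.
by split=> //; rewrite -{1}xv evT.
Qed.

Lemma evolution_comp t s r (v : 'cV[R]_n) : T t s *m (T s r *m v) = T t r *m v.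
Proof. by have [/evT h _] := evolution_solution r v; rewrite h. Qed.

Lemma evolution_lip t s v :
  N (T t s *m v) <= 2 * expw (fun t => M * t) s t * N v.
Proof.
have [sol Tss] := evolution_solution s v.
rewrite -{2}Tss.
apply: (@gronwall _ _ _ normN _ _ is_derive_scale_id (fun=> M0)
   (fun t => T t s *m v) (fun t => A t *m (T t s *m v))).
- by move=> r; apply/is_derive1P; exact: sol.
- by move=> r; exact: AM.
Qed.

Lemma mulmx_delta (B : 'M[R]_n) i j : B i j = (B *m delta_mx j (0 : 'I_1)) i 0.
Proof. by rewrite -colE mxE. Qed.

Lemma is_derive_evolution (s t : R) : is_derive t 1 (fun t => T t s) (A t *m T t s).
Proof.
apply/is_derive_mx => i j.
have -> : (fun t => T t s i j) = (fun t => (T t s *m delta_mx j (0 : 'I_1)) i 0).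
  by apply/funext => r; rewrite -mulmx_delta.
rewrite mulmx_delta -mulmxA.
have [/(_ t)/is_derive1P/is_derive_mx + _] := evolution_solution s (delta_mx j (0 : 'I_1)).
exact.
Qed.

(** Continuity in the initial time: in [T t s *m (T s s0 *m v - v)] the second factor tends to [0]
    as [s] tends to [s0], while the first is bounded for [s] near [s0] by Gronwall. *)
Lemma evolution_continuous t : continuous (T t).
Proof.
apply/continuous_mxP => i j.
have -> : (fun s => T t s i j) = (fun s => (T t s *m delta_mx j (0 : 'I_1)) i 0).
  by apply/funext => r; rewrite -mulmx_delta.
set v := delta_mx _ _.
suff : continuous (fun s => T t s *m v) by move=> /continuous_mxP; exact.
move=> s0; apply/(vnorm_cvgP normN) => e e0.
pose E := expw (fun t => M * t) t s0 + 1.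
have E0 : 0 < E by rewrite ltr_wpDl// ltW// expw_gt0.
have [sol Tss] := evolution_solution s0 v.
near=> s.
have -> : T t s0 *m v - T t s *m v = T t s *m (T s s0 *m v - v).
  by rewrite mulmxBr evolution_comp.
apply: le_trans (evolution_lip _ _ _) _.
have h1 : expw (fun t => M * t) s t <= E.
  have -> : expw (fun t => M * t) s t = expw (fun t => M * t) t s.
    by rewrite /expw distrC.
  have : `|expw (fun t => M * t) t s0 - expw (fun t => M * t) t s| <= 1.
    near: s.
    have /cvgrPdist_le := @expw_continuous _ _ _ is_derive_scale_id t s0; exact.
  by rewrite ler_norml /E; lra.
have h2 : N (T s s0 *m v - v) <= e / (2 * E).
  rewrite -{2}Tss (vnormC normN); near: s.
  have c : continuous (fun s => T s s0 *m v).
    apply: (@is_derive1_cont _ _ _ (fun t => A t *m (T t s0 *m v))) => r.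
    by apply/is_derive1P; exact: sol.
  have /(vnorm_cvgP normN) := c s0; apply.
  by rewrite divr_gt0// mulr_gt0.
have -> : e = 2 * E * (e / (2 * E)) by field; rewrite gt_eqF.
apply: ler_pM => //; first by rewrite mulr_ge0// ltW// expw_gt0.
  exact: vnorm_ge0.
by rewrite ler_pM2l.
Unshelve. all: by end_near. Qed.

(** * Dichotomy estimates in the time scale [L], which stands for [ln mu] *)

Section Dichotomy.
Variables (L dL : R -> R) (P : R -> 'M[R]_n) (K alpha : R).
Hypothesis LD : forall t : R, is_derive t 1 L (dL t).
Hypothesis dL0 : forall t, 0 <= dL t.
Hypothesis LNy : forall c, exists s, L s <= c.
Hypothesis Ly : forall c, exists s, c <= L s.
Hypothesis K0 : 0 < K.
Hypothesis a0 : 0 < alpha.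
Hypothesis TP : forall t s, T t s *m P s = P t *m T t s.
Hypothesis dichP : forall t s, s <= t ->
  opnorm_le N (T t s *m P s) (K * expR (alpha * (L s - L t))).
Hypothesis dichQ : forall t s, t <= s ->
  opnorm_le N (T t s *m (1%:M - P s)) (K * expR (alpha * (L t - L s))).

Lemma evolution_complement t s : T t s *m (1%:M - P s) = (1%:M - P t) *m T t s.
Proof. by rewrite mulmxBr mulmxBl mulmx1 mul1mx TP. Qed.

Lemma expR_small k e : 0 <= k -> 0 < e ->
  exists c, forall x, x <= c -> k * expR (alpha * x) <= e.
Proof.
move=> k0 e0; have k1 : 0 < k + 1 by lra.
have ek : 0 < e / (k + 1) by exact: divr_gt0.
exists (ln (e / (k + 1)) / alpha) => x; rewrite ler_pdivlMr// mulrC => xc.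
apply: (@le_trans _ _ (k * (e / (k + 1)))).
  by rewrite ler_wpM2l// -[leRHS]lnK ?posrE// ler_expR.
by rewrite mulrCA ler_piMr ?(ltW e0)// ler_pdivrMr//; lra.
Qed.

Lemma decay_Ny k e t : 0 <= k -> 0 < e ->
  exists2 s, s <= t & k * expR (alpha * (L s - L t)) <= e.
Proof.
move=> k0 e0; have [c hc] := expR_small k0 e0.
have [s Ls] := LNy (c + L t); exists (Num.min s t); first by rewrite ge_min lexx orbT.
apply: hc; rewrite lerBlDr; apply: le_trans Ls.
by apply: (ge0_derive_ndecr LD dL0); rewrite ge_min lexx.
Qed.

Lemma decay_y k e t : 0 <= k -> 0 < e ->
  exists2 s, t <= s & k * expR (alpha * (L t - L s)) <= e.
Proof.
move=> k0 e0; have [c hc] := expR_small k0 e0.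
have [s Ls] := Ly (L t - c); exists (Num.max s t); first by rewrite le_max lexx orbT.
apply: hc; rewrite lerBlDr addrC -lerBlDr; apply: le_trans Ls _.
by apply: (ge0_derive_ndecr LD dL0); rewrite le_max lexx.
Qed.

(** The stable part of [y t] is carried from a time [s] in the far past, the unstable part from the
    far future; boundedness and the dichotomy make both arbitrarily small. *)
Lemma bounded_linear_eq0 y B :
  is_solution (fun t v => A t *m v) y -> (forall t, N (y t) <= B) ->
  forall t, y t = 0.
Proof.
move=> /evT ysol yB t; apply: (vnorm_small_eq0 normN) => e e0.
have e2 : 0 < e / 2 by lra.
have B0 : 0 <= B by apply: le_trans (yB t); exact: vnorm_ge0.
have KB : 0 <= K * B by rewrite mulr_ge0// ltW.
have -> : y t = P t *m y t + (1%:M - P t) *m y t.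
  by rewrite mulmxBl mul1mx addrC subrK.
have hP : N (P t *m y t) <= e / 2.
  have [s st es] := decay_Ny t KB e2.
  rewrite -(ysol t s) mulmxA -TP; apply: le_trans (dichP st _) _.
  apply: le_trans es; rewrite mulrAC ler_wpM2r ?expR_ge0//.
  by rewrite ler_wpM2l// ltW.
have hQ : N ((1%:M - P t) *m y t) <= e / 2.
  have [s st es] := decay_y t KB e2.
  rewrite -(ysol t s) mulmxA -evolution_complement; apply: le_trans (dichQ st _) _.
  apply: le_trans es; rewrite mulrAC ler_wpM2r ?expR_ge0//.
  by rewrite ler_wpM2l// ltW.
apply: le_trans (vnormD normN _ _) _; lra.
Qed.

Section Inhomogeneous.
Variables (g : R -> 'cV[R]_n) (b : R).
Hypothesis cg : continuous g.
Hypothesis b0 : 0 <= b.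
Hypothesis gb : forall t, N (g t) <= b * dL t.

Let k := K * b / alpha.

Let k0 : 0 <= k.
Proof. by rewrite /k divr_ge0 ?mulr_ge0// ltW. Qed.

(** By invariance of the projections the differentiated curve has derivative [T t q *m P q *m g q].
    Its norm is at most [K * b * dL q * expR (alpha * (L q - L t))], which is the derivative of
    [k * expR (alpha * (L q - L t))]. *)
Lemma stable_increment_le (v : R -> 'cV[R]_n) :
  (forall s : R, is_derive s 1 v (T 0 s *m g s)) ->
  forall t r s, s <= r -> r <= t ->
  N (T t 0 *m (P 0 *m v r - P 0 *m v s)) <= k * expR (alpha * (L r - L t)).
Proof.
move=> vD t r s sr rt.
have wD (q : R) : is_derive q 1 (fun q => T t 0 *m (P 0 *m v q))
    (T t 0 *m (P 0 *m (T 0 q *m g q))).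
  by apply: is_derive_mulmxl; apply: is_derive_mulmxl; exact: vD.
have := mean_value_ineq normN sr wD
  (is_derive_expR_phi LD alpha (- (alpha * L t)) k).
have E q : alpha * L q - alpha * L t = alpha * (L q - L t) by rewrite mulrBr.
rewrite !E -mulmxBr => h; apply: le_trans (h _) _; last first.
  by rewrite gerBl mulr_ge0// expR_ge0.
move=> q /andP[_ qr].
rewrite [P 0 *m _]mulmxA -TP -mulmxA evolution_comp mulmxA.
apply: le_trans (dichP (le_trans qr rt) _) _.
have := gb q; rewrite /k E => h'.
have -> : K * b / alpha * (alpha * dL q * expR (alpha * (L q - L t))) =
    K * expR (alpha * (L q - L t)) * (b * dL q) by field; rewrite gt_eqF.
by rewrite ler_wpM2l// mulr_ge0 ?expR_ge0// ltW.
Qed.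

(** Mirror image of the stable case, with the comparison function
    [- k * expR (alpha * (L t - L q))], nondecreasing in [q]. *)
Lemma unstable_increment_le (v : R -> 'cV[R]_n) :
  (forall s : R, is_derive s 1 v (T 0 s *m g s)) ->
  forall t r s, t <= r -> r <= s ->
  N (T t 0 *m ((1%:M - P 0) *m v r - (1%:M - P 0) *m v s)) <=
  k * expR (alpha * (L t - L r)).
Proof.
move=> vD t r s tr rs.
have wD (q : R) : is_derive q 1 (fun q => T t 0 *m ((1%:M - P 0) *m v q))
    (T t 0 *m ((1%:M - P 0) *m (T 0 q *m g q))).
  by apply: is_derive_mulmxl; apply: is_derive_mulmxl; exact: vD.
have := mean_value_ineq normN rs wD
  (is_derive_expR_phi LD (- alpha) (alpha * L t) (- k)).
have E q : - alpha * L q + alpha * L t = alpha * (L t - L q) by ring.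
rewrite !E (vnormC normN) -mulmxBr => h; apply: le_trans (h _) _; last first.
  by have := mulr_ge0 k0 (expR_ge0 (alpha * (L t - L s))); lra.
move=> q /andP[rq _].
rewrite [(1%:M - P 0) *m _]mulmxA -evolution_complement -mulmxA evolution_comp mulmxA.
apply: le_trans (dichQ (le_trans tr rq) _) _.
have := gb q; rewrite /k E => h'.
have -> : - (K * b / alpha) * (- alpha * dL q * expR (alpha * (L t - L q))) =
    K * expR (alpha * (L t - L q)) * (b * dL q) by field; rewrite gt_eqF.
by rewrite ler_wpM2l// mulr_ge0 ?expR_ge0// ltW.
Qed.

(* Variation of constants: with v' = T(0,s) g, the bounded solution is
   T(t,0) (v - c1 - c2), where c1 is the limit of P(0) v at -oo and c2 the limit of
   (1 - P(0)) v at +oo. *)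
Lemma bounded_inhomogeneous : exists2 z : R -> 'cV[R]_n,
  (forall t : R, is_derive t 1 z (A t *m z t + g t)) &
  forall t, N (z t) <= 2 * K * b / alpha.
Proof.
have cTg : continuous (fun s => T 0 s *m g s).
  by apply: continuous_mulmx => //; exact: evolution_continuous.
have [v vD] := continuous_primitive_mx cTg.
have T00 (x : 'cV[R]_n) : T 0 0 *m x = x by have [] := evolution_solution 0 x.
have kexp t r : r <= t -> k * expR (alpha * (L r - L t)) <= k.
  move=> rt; rewrite ler_piMr// -[leRHS]expR0 ler_expR.
  by rewrite mulr_ge0_le0 ?(ltW a0)// subr_le0 (ge0_derive_ndecr LD dL0).
have [|c1 c1P] := @vnorm_cauchy_cvg _ _ _ normN (-oo%R : set_system R) _ (fun s => P 0 *m v s).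
  move=> e e0; have [r r0 re] := decay_Ny 0 k0 e0.
  exists (P 0 *m v r); near=> s.
  have := @stable_increment_le v vD 0 r s; rewrite T00 => h.
  apply: le_trans (h _ r0) re.
  by near: s; apply: nbhs_ninfty_le; exact: num_real.
have [|c2 c2P] := @vnorm_cauchy_cvg _ _ _ normN (+oo%R : set_system R) _
    (fun s => (1%:M - P 0) *m v s).
  move=> e e0; have [r r0 re] := decay_y 0 k0 e0.
  exists ((1%:M - P 0) *m v r); near=> s.
  have := @unstable_increment_le v vD 0 r s; rewrite T00 => h.
  apply: le_trans (h r0 _) re.
  by near: s; apply: nbhs_pinfty_ge; exact: num_real.
exists (fun t => T t 0 *m (v t - (c1 + c2))) => t.
- have vcD := is_deriveB (vD t) (is_derive_cst (c1 + c2) t 1).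
  have := is_derive_mulmx (is_derive_evolution 0 t) vcD.
  rewrite subr0 -mulmxA evolution_comp.
  by have [_ ->] := evolution_solution t (g t).
- have -> : v t - (c1 + c2) = (P 0 *m v t - c1) + ((1%:M - P 0) *m v t - c2).
    by rewrite mulmxBl mul1mx addrACA -opprD [P 0 *m _ + _]addrC subrK.
  rewrite mulmxDr (le_trans (vnormD normN _ _))//.
  (* The stable and the unstable part contribute [k] each, as limits of the increment estimates with
     [r = t]. *)
  have -> : 2 * K * b / alpha = k + k by rewrite /k; ring.
  apply: lerD.
  + apply: (vnorm_mulmx_lim_le normN _ c1P); near=> s.
    apply: le_trans (stable_increment_le vD _ (lexx t)) (kexp _ _ (lexx t)).
    by near: s; apply: nbhs_ninfty_le; exact: num_real.
  + apply: (vnorm_mulmx_lim_le normN _ c2P); near=> s.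
    apply: le_trans (unstable_increment_le vD (lexx t) _) (kexp _ _ (lexx t)).
    by near: s; apply: nbhs_pinfty_ge; exact: num_real.
Unshelve. all: by end_near. Qed.

(** Any bound [B], however large, improves to the explicit one, since [d] must coincide with the
    bounded solution already found. This yields the contraction and uniqueness estimates below. *)
Lemma bounded_inhomogeneous_le (d : R -> 'cV[R]_n) B :
  (forall t : R, is_derive t 1 d (A t *m d t + g t)) -> (forall t, N (d t) <= B) ->
  forall t, N (d t) <= 2 * K * b / alpha.
Proof.
move=> dD dB t; have [z zD zB] := bounded_inhomogeneous.
suff /eqP : d t - z t = 0 by rewrite subr_eq0 => /eqP ->.
apply: (@bounded_linear_eq0 (fun t => d t - z t) (B + 2 * K * b / alpha)).
- move=> s; apply/is_derive1P; have := is_deriveB (dD s) (zD s).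
  by rewrite opprD addrACA subrr addr0 -mulmxBr.
- by move=> s; apply: le_trans (vnormB normN _ _) (lerD (dB s) (zB s)).
Qed.

End Inhomogeneous.
End Dichotomy.
End Linear.

(** * Partner solutions and the conjugacy *)

(** Near [x] the values of [h] stay in a compact ball. A cluster point [p] of [h] at [x] has
    [(x, p)] in the closed set [C], hence equals [h x], and a single cluster point in a compact set
    is a limit. *)
Lemma closed_graph_continuous (R : realType) (n : nat)
    (h : 'cV[R]_n -> 'cV[R]_n) (C : set ('cV[R]_n * 'cV[R]_n)) (B : R) :
  closed C -> (forall x, C (x, h x)) -> (forall x y, C (x, y) -> y = h x) ->
  (forall x, `|h x - x| <= B) -> continuous h.
Proof.
move=> clC Ch Ceq hB x.
(* Large enough for all [h x'] with [x'] within [1] of [x], and leaving [h x] strictly inside the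
   ball. *)
pose M := `|x| + B + 2.
have hx x' : `|h x'| <= `|x'| + B.
  by rewrite -(subrK x' (h x')) (le_trans (ler_normD _ _))// addrC lerD2l.
have cV := @closed_ball_cV_compact R n M.
have hV : \forall x' \near x, [set v | `|v| <= M] (h x').
  near=> x'; rewrite /= (le_trans (hx _))// /M.
  have : `|x - x'| <= 1.
    by near: x'; have /cvgrPdist_le := @cvg_id _ (nbhs x); exact.
  by have := ler_normB x (x - x'); rewrite subKr; lra.
have clh : cluster (h @ x) `<=` [set h x].
  move=> p clp; apply: Ceq; apply: clC => W [[W1 W2] /= [W1x W2p] W12].
  have [|_ [[x' W1x' <-] W2x']] := clp (h @` W1) W2 _ W2p.
    by apply: filterS W1x => x' W1x'; exists x'.
  by exists (x', h x'); split; [exact: Ch|exact: W12].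
have hF : ProperFilter (h @ x) := fmap_proper_filter h (nbhs_pfilter x).
apply: (compact_cluster_set1 _ cV _ hF hV).
- exact: norm_hausdorff.
- have hxM : `|h x| < M by rewrite (le_lt_trans (hx x))// /M; lra.
  near=> v; rewrite /= ltW//.
  by near: v; have /cvgr_lt := @norm_continuous _ _ (h x); exact.
- apply/seteqP; split => // p ->.
  have [p' [_ clp']] := cV (h @ x) hF hV.
  by rewrite -(clh _ clp').
Unshelve. all: by end_near. Qed.

(** * Existence and uniqueness of partners, and the maps [H] and [G] *)

Section Linearization.
Variables (R : realType) (n : nat) (N : 'cV[R]_n -> R) (A : R -> 'M[R]_n).
Variables (T : R -> R -> 'M[R]_n) (M : R).
Hypothesis normN : is_norm N.
Hypothesis cA : continuous A.
Hypothesis M0 : 0 <= M.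
Hypothesis AM : forall t, opnorm_le N (A t) M.
Hypothesis evT : evolution_operator A T.
Variables (L dL : R -> R) (P : R -> 'M[R]_n) (K alpha : R).
Hypothesis LD : forall t : R, is_derive t 1 L (dL t).
Hypothesis dL0 : forall t, 0 <= dL t.
Hypothesis LNy : forall c, exists s, L s <= c.
Hypothesis Ly : forall c, exists s, c <= L s.
Hypothesis K0 : 0 < K.
Hypothesis a0 : 0 < alpha.
Hypothesis TP : forall t s, T t s *m P s = P t *m T t s.
Hypothesis dichP : forall t s, s <= t ->
  opnorm_le N (T t s *m P s) (K * expR (alpha * (L s - L t))).
Hypothesis dichQ : forall t s, t <= s ->
  opnorm_le N (T t s *m (1%:M - P s)) (K * expR (alpha * (L t - L s))).
Variables (f : R -> 'cV[R]_n -> 'cV[R]_n) (beta gamma : R).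
Hypothesis cf : continuous (fun p : R * 'cV[R]_n => f p.1 p.2).
Hypothesis beta0 : 0 <= beta.
Hypothesis gamma0 : 0 <= gamma.
Hypothesis fb : forall t x, N (f t x) <= beta * dL t.
Hypothesis fl : forall t x1 x2,
  N (f t x1 - f t x2) <= gamma * dL t * N (x1 - x2).
Hypothesis q1 : 2 * K * gamma / alpha < 1.

Let lin := fun t (v : 'cV[R]_n) => A t *m v.
Let nonlin := fun t (v : 'cV[R]_n) => A t *m v + f t v.
Let B := 2 * K * beta / alpha.
Let q := 2 * K * gamma / alpha.

Let q01 : 0 <= q < 1.
Proof. by rewrite q1 andbT /q divr_ge0 ?mulr_ge0// ltW. Qed.

Let inhom_ex := bounded_inhomogeneous normN cA M0 AM evT LD dL0 LNy Ly K0 a0 TP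
  dichP dichQ.

Let inhom_le := bounded_inhomogeneous_le normN cA M0 AM evT LD dL0 LNy Ly K0 a0 TP
  dichP dichQ.

Let lin_eq0 := bounded_linear_eq0 normN evT LD dL0 LNy Ly K0 a0 TP
  dichP dichQ.

Lemma continuous_superposition (u : R -> 'cV[R]_n) :
  continuous u -> continuous (fun t => f t (u t)).
Proof.
move=> cu t; apply: (@continuous_comp _ _ _ (fun t => (t, u t))
  (fun p => f p.1 p.2)); last exact: cf.
exact: (cvg_pair (@cvg_id _ (nbhs t)) (cu t)).
Qed.

Lemma solution_continuous (F : R -> 'cV[R]_n -> 'cV[R]_n) x :
  is_solution F x -> continuous x.
Proof.
move=> xs; apply: (@is_derive1_cont _ _ _ (fun t => F t (x t))) => t.
by apply/is_derive1P; exact: xs.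
Qed.

(** Its derivative dominates both the Lipschitz constant [M + gamma * dL t] of [nonlin t] and the
    size [beta * dL t] of [nonlin t 0], as [ode_exists] and [gronwall] demand. *)
Let phi t := M * t + (gamma + beta) * L t.
Let dphi t := M + (gamma + beta) * dL t.

Let phiD (t : R) : is_derive t 1 phi (dphi t).
Proof.
exact: is_deriveD (is_derive_scale_id M t) (is_deriveZ (gamma + beta) (LD t)).
Qed.

Let dphi0 t : 0 <= dphi t.
Proof. by rewrite /dphi addr_ge0// mulr_ge0// addr_ge0. Qed.

Lemma nonlinear_lipschitz t x y :
  N (nonlin t x - nonlin t y) <= dphi t * N (x - y).
Proof.
rewrite /nonlin opprD addrACA -mulmxBr (le_trans (vnormD normN _ _))//.
rewrite mulrDl lerD//; first exact: AM.
apply: le_trans (fl _ _ _) _; rewrite ler_wpM2r ?(vnorm_ge0 normN)//.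
by rewrite ler_wpM2r// lerDl.
Qed.

Lemma nonlinear_exists tau xi : exists2 x, is_solution nonlin x & x tau = xi.
Proof.
apply: (ode_exists normN phiD dphi0).
- move=> u cu t; apply: cvgD.
    exact: (continuous_mulmx cA cu).
  exact: continuous_superposition cu t.
- exact: nonlinear_lipschitz.
- move=> t; rewrite /nonlin mulmx0 add0r (le_trans (fb _ _))// /dphi.
  by rewrite mulrDl; have := mulr_ge0 gamma0 (dL0 t); move: M0; lra.
Qed.

(** Gives at once uniqueness for the initial value problem and continuity of the nonlinear flow in
    the initial value. *)
Lemma nonlinear_dependence x y tau t :
  is_solution nonlin x -> is_solution nonlin y ->
  N (x t - y t) <= 2 * expw phi tau t * N (x tau - y tau).
Proof.
move=> xs ys; apply: (@gronwall _ _ _ normN _ _ phiD dphi0 (fun t => x t - y t)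
  (fun t => nonlin t (x t) - nonlin t (y t))).
- move=> r; have /is_derive1P xD := xs r; have /is_derive1P yD := ys r.
  exact: is_deriveB.
- by move=> r; exact: nonlinear_lipschitz.
Qed.

Lemma linear_partner x : is_solution nonlin x ->
  exists2 y, is_solution lin y & forall t, N (x t - y t) <= B.
Proof.
move=> xs; have cg : continuous (fun t => - f t (x t)).
  by move=> t; apply: cvgN; exact: (continuous_superposition (solution_continuous xs)).
have [|z zD zB] := inhom_ex cg beta0; first by move=> t; rewrite (vnormN normN).
exists (fun t => x t + z t) => t.
  apply/is_derive1P; have /is_derive1P xD := xs t.
  apply: is_derive_eq (is_deriveD xD (zD t)) _.
  by rewrite /nonlin /lin mulmxDr addrACA subrr addr0.
by rewrite opprD addrA subrr add0r (vnormN normN).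
Qed.

(** The partner is sought as [y + z], where [z] is a fixed point of the map sending [z] to the
    bounded solution [Z] of [Z' = A Z + f(t, y + z)]. *)
Lemma nonlinear_partner y : is_solution lin y ->
  exists2 x, is_solution nonlin x & forall t, N (x t - y t) <= B.
Proof.
move=> ys; have cy := solution_continuous ys.
have cg (z : R -> 'cV[R]_n) : continuous z -> continuous (fun t => f t (y t + z t)).
  by move=> cz; apply: continuous_superposition => t; apply: cvgD; [exact: cy|exact: cz].
have /choice[Phi PhiP] : forall z : R -> 'cV[R]_n, exists Z : R -> 'cV[R]_n,
    continuous z ->
    (forall t : R, is_derive t 1 Z (A t *m Z t + f t (y t + z t))) /\
    (forall t, N (Z t) <= B).
  move=> z; have [cz|ncz] := pselect (continuous z); last by exists z.
  have [|Z ZD ZB] := inhom_ex (cg z cz) beta0; first by move=> t; exact: fb.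
  by exists Z.
have B0 : 0 <= B by rewrite /B divr_ge0 ?mulr_ge0// ltW.
(* The weight is constant, so this is a contraction in the supremum norm, started at [0]; [B] bounds
   every image. *)
have [||||||||z cz zE] := @weighted_contraction _ _ _ normN Phi (cst 1) q B (cst 0).
- exact: cst_continuous.
- by [].
- exact: q01.
- exact: B0.
- by move=> u /PhiP[uD _]; exact: is_derive1_cont uD.
- move=> u v D cu cv D0 uv t.
  have [uD uB] := PhiP u cu; have [vD vB] := PhiP v cv.
  rewrite mulr1 (_ : q * D = 2 * K * (gamma * D) / alpha); last by rewrite /q; ring.
  (* The difference of the two images is bounded by [B + B] and solves the system forced by the
     difference of the [f] terms, so the bound improves to [q * D]. *)
  apply: (@inhom_le (fun t => f t (y t + u t) - f t (y t + v t)) (gamma * D)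
    _ _ _ (fun t => Phi u t - Phi v t) (B + B)).
  + by move=> s; apply: cvgB; exact: cg.
  + exact: mulr_ge0.
  + move=> s; apply: le_trans (fl _ _ _) _; rewrite mulrAC ler_wpM2r//.
    by rewrite ler_wpM2l// opprD addrACA subrr add0r; have := uv s; rewrite mulr1.
  + move=> s; apply: is_derive_eq (is_deriveB (uD s) (vD s)) _.
    by rewrite mulmxBr opprD addrACA.
  + by move=> s; apply: le_trans (vnormB normN _ _) (lerD (uB s) (vB s)).
- exact: cst_continuous.
- have c0 : continuous (cst 0 : R -> 'cV[R]_n) by exact: cst_continuous.
  move=> t; have [_ zB] := PhiP _ c0.
  by rewrite /cst /= subr0 mulr1.
have [zD zB] := PhiP z cz; have {}zE : Phi z = z by apply/funext.
rewrite zE in zD zB.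
exists (fun t => y t + z t) => t; last by rewrite addrAC subrr add0r.
apply/is_derive1P; have /is_derive1P yD := ys t.
apply: is_derive_eq (is_deriveD yD (zD t)) _.
by rewrite /nonlin /lin mulmxDr addrA.
Qed.

Lemma linear_partner_unique x y1 y2 :
  is_solution lin y1 -> is_solution lin y2 ->
  (forall t, N (x t - y1 t) <= B) -> (forall t, N (x t - y2 t) <= B) ->
  y1 = y2.
Proof.
move=> y1s y2s h1 h2; apply/funext => t; apply/eqP; rewrite -subr_eq0; apply/eqP.
apply: (@lin_eq0 (fun t => y1 t - y2 t) (B + B)).
- move=> s; have /is_derive1P y1D := y1s s; have /is_derive1P y2D := y2s s.
  by apply/is_derive1P; apply: is_derive_eq (is_deriveB y1D y2D) _; rewrite mulmxBr.
- move=> s; apply: le_trans (vnorm_tri normN (x s) _ _) _.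
  by rewrite (vnormC normN) lerD.
Qed.

(** The difference is bounded by [B + B], and [inhom_le] turns each bound [D] into [q * D];
    iteration forces it to vanish. *)
Lemma nonlinear_partner_unique y x1 x2 :
  is_solution nonlin x1 -> is_solution nonlin x2 ->
  (forall t, N (x1 t - y t) <= B) -> (forall t, N (x2 t - y t) <= B) ->
  x1 = x2.
Proof.
move=> x1s x2s h1 h2; apply/funext => t; apply/eqP; rewrite -subr_eq0; apply/eqP.
have B0 : 0 <= B by rewrite /B divr_ge0 ?mulr_ge0// ltW.
have qk k s : N (x1 s - x2 s) <= q ^+ k * (B + B).
  elim: k s => [|k IH] s.
    rewrite expr0 mul1r (le_trans (vnorm_tri normN (y s) _ _))//.
    by rewrite (vnormC normN (y s)) lerD.
  rewrite exprS -mulrA.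
  have D0 : 0 <= q ^+ k * (B + B).
    by case/andP: q01 => ? _; rewrite mulr_ge0 ?exprn_ge0 ?addr_ge0.
  set D := q ^+ k * (B + B) in IH D0 *.
  rewrite (_ : q * D = 2 * K * (gamma * D) / alpha); last by rewrite /q; ring.
  apply: (@inhom_le (fun t => f t (x1 t) - f t (x2 t)) (gamma * D)
    _ _ _ (fun t => x1 t - x2 t) D _ IH).
  + move=> r; apply: cvgB; apply: continuous_superposition;
      exact: solution_continuous.
  + exact: mulr_ge0.
  + by move=> r; apply: le_trans (fl _ _ _) _; rewrite mulrAC ler_wpM2r// ler_wpM2l.
  + move=> r; have /is_derive1P x1D := x1s r; have /is_derive1P x2D := x2s r.
    apply: is_derive_eq (is_deriveB x1D x2D) _.
    by rewrite /nonlin mulmxBr opprD addrACA.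
apply: (vnorm_small_eq0 normN) => e e0.
by have [k qe] := expr_small q01 (B + B) e0; apply: le_trans qe.
Qed.

Lemma dichotomy_linearization : exists H G : R -> 'cV[R]_n -> 'cV[R]_n,
  [/\ (forall t, [/\ cancel (H t) (G t), cancel (G t) (H t),
                    continuous (H t) & continuous (G t)]),
      (forall t x, N (H t x - x) <= B),
      (forall t y, N (G t y - y) <= B),
      (forall x, is_solution nonlin x -> is_solution lin (fun t => H t (x t)))
    & (forall y, is_solution lin y -> is_solution nonlin (fun t => G t (y t)))].
Proof.
have /choice[X XP] : forall p : R * 'cV[R]_n, exists x,
    is_solution nonlin x /\ x p.1 = p.2.
  by move=> [tau xi]; have [x] := nonlinear_exists tau xi; exists x.
have XE x t : is_solution nonlin x -> X (t, x t) = x.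
  move=> xs; have [Xs Xt] := XP (t, x t); apply/funext => s; apply/eqP.
  rewrite -subr_eq0; apply/eqP; apply: (vnorm_eq0 normN); apply/eqP.
  rewrite eq_le (vnorm_ge0 normN) andbT.
  by have := nonlinear_dependence t s Xs xs; rewrite Xt subrr (vnorm0 normN) mulr0.
pose Y (p : R * 'cV[R]_n) := fun s => T s p.1 *m p.2.
have Ys p : is_solution lin (Y p).
  by have [] := evolution_solution normN cA M0 AM evT p.1 p.2.
have Yt p : Y p p.1 = p.2.
  by have [_] := evolution_solution normN cA M0 AM evT p.1 p.2.
have YE y t : is_solution lin y -> Y (t, y t) = y.
  by move=> /evT ys; apply/funext => s; rewrite /Y /= ys.
(* Partners are chosen for whole trajectories; a function that is not a solution is sent to itself
   as a dummy value. *)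
have /choice[h hP] : forall x, exists y, is_solution nonlin x ->
    is_solution lin y /\ forall t, N (x t - y t) <= B.
  move=> x; have [xs|nx] := pselect (is_solution nonlin x); last by exists x.
  by have [y] := linear_partner xs; exists y.
have /choice[g gP] : forall y, exists x, is_solution lin y ->
    is_solution nonlin x /\ forall t, N (x t - y t) <= B.
  move=> y; have [ys|ny] := pselect (is_solution lin y); last by exists y.
  by have [x] := nonlinear_partner ys; exists x.
pose H t xi := h (X (t, xi)) t; pose G t eta := g (Y (t, eta)) t.
(* The key fact: along partner trajectories [H t] takes [x t] to [y t] at every [t]. With its mirror
   [GE] it yields the inverse relations and the transport of solutions. *)
have HE x y t : is_solution nonlin x -> is_solution lin y ->
    (forall s, N (x s - y s) <= B) -> H t (x t) = y t.
  move=> xs ys xy; rewrite /H XE//; have [hs hB] := hP x xs.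
  by rewrite (linear_partner_unique hs ys hB xy).
have GE x y t : is_solution nonlin x -> is_solution lin y ->
    (forall s, N (x s - y s) <= B) -> G t (y t) = x t.
  move=> xs ys xy; rewrite /G YE//; have [gs gB] := gP y ys.
  by rewrite (nonlinear_partner_unique gs xs gB xy).
have HK t : cancel (H t) (G t).
  move=> xi; have [Xs Xt] := XP (t, xi); have [hs hB] := hP _ Xs.
  by rewrite /H (GE _ _ _ Xs hs hB).
have GK t : cancel (G t) (H t).
  move=> eta; have [gs gB] := gP _ (Ys (t, eta)).
  by rewrite /G (HE _ _ _ gs (Ys _) gB) Yt.
have HB t x : N (H t x - x) <= B.
  have [Xs Xt] := XP (t, x); have [hs hB] := hP _ Xs.
  by have := hB t; rewrite Xt (vnormC normN).
have GB t y : N (G t y - y) <= B.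
  by have [gs gB] := gP _ (Ys (t, y)); have := gB t; rewrite Yt.
have [c c0 cN] := normr_le_vnorm normN.
(* The common graph, described by inequalities between the flows. It is closed as an intersection
   over [s] of closed conditions. *)
pose C t := [set p : 'cV[R]_n * 'cV[R]_n |
  forall s, N (X (t, p.1) s - Y (t, p.2) s) <= B].
have cX t s : continuous (fun xi => X (t, xi) s).
  move=> xi.
  apply: (@vnorm_cvgP _ _ _ normN _ (nbhs xi) _ (fun xi => X (t, xi) s) _).2 => e e0.
  have E0 : 0 < 2 * expw phi t s by rewrite mulr_gt0// expw_gt0.
  near=> xi'.
  have [Xs Xt] := XP (t, xi); have [Xs' Xt'] := XP (t, xi').
  apply: le_trans (nonlinear_dependence t s Xs Xs') _; rewrite Xt Xt' /=.
  rewrite mulrC -ler_pdivlMr//; near: xi'.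
  have := (@vnorm_cvgP _ _ _ normN _ (nbhs xi) _ id xi).1 (@cvg_id _ _).
  by apply; exact: divr_gt0.
have cY t s : continuous (fun eta => Y (t, eta) s).
  rewrite /Y /=; apply: (@continuous_mulmx _ _ _ _ _ (cst (T s t)) id).
    exact: cst_continuous.
  by move=> v.
have clC t : closed (C t).
  have -> : C t = \bigcap_s ((fun p : 'cV[R]_n * 'cV[R]_n =>
      N (X (t, p.1) s - Y (t, p.2) s)) @^-1` [set r | r <= B]).
    by apply/seteqP; split => p h1 s; [move=> _; exact: h1|exact: h1].
  apply: closed_bigI => s _; apply: closed_comp; last exact: closed_le.
  move=> p _.
  apply: (@continuous_comp _ _ _ (fun p : 'cV[R]_n * 'cV[R]_n =>
      X (t, p.1) s - Y (t, p.2) s) N); last exact: vnorm_continuous.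
  apply: cvgB.
    by apply: (@continuous_comp _ _ _ fst (fun xi => X (t, xi) s));
      [exact: cvg_fst|exact: cX].
  by apply: (@continuous_comp _ _ _ snd (fun eta => Y (t, eta) s));
      [exact: cvg_snd|exact: cY].
have CH t x : C t (x, H t x).
  have [Xs Xt] := XP (t, x); have [hs hB] := hP _ Xs.
  by move=> s; rewrite /= /H YE.
have CHE t x y : C t (x, y) -> y = H t x.
  move=> Cxy; have [Xs Xt] := XP (t, x).
  by have := HE _ _ t Xs (Ys (t, y)) Cxy; rewrite Xt Yt.
have cH t : continuous (H t).
  apply: (closed_graph_continuous (clC t) (CH t) (CHE t) (B := c * B)) => x.
  by rewrite (le_trans (cN _))// ler_pM2l.
have cG t : continuous (G t).
  (* The graph of [G t] is that of [H t] with the coordinates exchanged. *)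
  pose sw (p : 'cV[R]_n * 'cV[R]_n) := (p.2, p.1).
  have clCs : closed (sw @^-1` C t).
    apply: closed_comp (clC t) => p _.
    case: p => p1 p2.
    exact: (cvg_pair (@cvg_snd _ _ (nbhs p1) (nbhs p2) _) (@cvg_fst _ _ (nbhs p1) (nbhs p2) _)).
  apply: (closed_graph_continuous clCs (B := c * B)).
  - by move=> y; have := CH t (G t y); rewrite GK.
  - by move=> y x /CHE; rewrite /= => ->; rewrite HK.
  - by move=> y; rewrite (le_trans (cN _))// ler_pM2l.
exists H, G; split => //.
- move=> x xs; have [hs hB] := hP x xs.
  by rewrite (_ : (fun t => _) = h x)//; apply/funext => t; exact: HE.
- move=> y ys; have [gs gB] := gP y ys.
  by rewrite (_ : (fun t => _) = g y)//; apply/funext => t; exact: GE.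
Unshelve. all: by end_near. Qed.

End Linearization.

(** * Passage from [mu] to [L = ln mu] *)

Lemma powR_ln (R : realType) (a b c : R) : 0 < a -> 0 < b ->
  powR (a / b) (- c) = expR (c * (ln b - ln a)).
Proof.
move=> a0 b0; rewrite /powR gt_eqF ?divr_gt0//.
by rewrite ln_div ?posrE// mulNr -mulrN opprB.
Qed.

Unset Implicit Arguments.

Theorem theorem2p1 (R : realType) (n : nat) (N : 'cV[R]_n -> R)
  (A : R -> 'M[R]_n) (T : R -> R -> 'M[R]_n) (mu : R -> R)
  (P : R -> 'M[R]_n) (K alpha : R)
  (f : R -> 'cV[R]_n -> 'cV[R]_n) (beta gamma : R) :
  is_norm N ->
  continuous A ->
  (exists M : R, forall t, opnorm_le N (A t) M) ->
  growth_rate mu ->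
  evolution_operator A T ->
  algebraic_dichotomy N T mu P K alpha ->
  continuous (fun p : R * 'cV[R]_n => f p.1 p.2) ->
  0 <= beta -> 0 <= gamma ->
  (forall t x, N (f t x) <= beta * (derive1 mu t / mu t)) ->
  (forall t x1 x2, N (f t x1 - f t x2) <= gamma * (derive1 mu t / mu t) * N (x1 - x2)) ->
  6 * K * gamma / alpha < 1 ->
  exists H G : R -> 'cV[R]_n -> 'cV[R]_n,
    [/\ (forall t, [/\ cancel (H t) (G t), cancel (G t) (H t),
                      continuous (H t) & continuous (G t)]),
        (forall t x, N (H t x - x) <= 2 * K * beta / alpha),
        (forall t y, N (G t y - y) <= 2 * K * beta / alpha),
        (forall x, is_solution (fun t v => A t *m v + f t v) x ->
                   is_solution (fun t v => A t *m v) (fun t => H t (x t)))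
      & (forall y, is_solution (fun t v => A t *m v) y ->
                   is_solution (fun t v => A t *m v + f t v) (fun t => G t (y t)))].
Proof.
move=> normN cA [M AM] [mu_incr mu_drv mu_gt0 _ [muNy muy]] evT
  [[K0 a0] _ TP dP dQ] cf beta0 gamma0 fb fl q6.
(* The given bound on [A] carries no sign, hence the absolute value of [M]. The derivative of
   [ln mu] is the quotient [mu' / mu] that bounds [f]. *)
refine (@dichotomy_linearization R n N A T `|M| normN cA _ _ evT
  (fun t => ln (mu t))
  (fun t => derive1 mu t / mu t) P K alpha _ _ _ _ K0 a0 TP _ _ f beta gamma
  cf beta0 gamma0 fb fl _) => //.
- by move=> t x; apply: le_trans (AM t x) _; rewrite ler_wpM2r ?ler_norm ?vnorm_ge0.
- move=> t; rewrite mulrC; apply: is_derive1_comp; first exact: is_derive1_ln.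
  by apply/is_derive1P; split.
- move=> t; rewrite divr_ge0 ?(ltW (mu_gt0 t))//.
  apply: (@incr_derive1_ge0 _ _ setT); rewrite ?interiorT//.
  by move=> x y _ _; exact: mu_incr.
(* The limits of [mu] at both ends make [ln mu] unbounded below and above: [mu] passes [expR c] for
   every [c]. *)
- move=> c; have /cvgr_le /(_ _ (expR_gt0 c)) muc := muNy.
  have [s sc] := @filter_ex _ _ _ _ muc.
  by exists s; rewrite /= -[leRHS]expRK ler_ln ?posrE ?expR_gt0.
- move=> c; have /cvgryPge /(_ (expR c)) muc := muy.
  have [s sc] := @filter_ex _ _ _ _ muc.
  by exists s; rewrite /= -[leLHS]expRK ler_ln ?posrE ?expR_gt0.
- by move=> t s st x; have := dP t s st x; rewrite powR_ln.
- by move=> t s ts x; have := dQ t s ts x; rewrite powR_ln.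
- apply: le_lt_trans q6; rewrite ler_wpM2r ?invr_ge0 ?(ltW a0)//.
  by rewrite ler_wpM2r// ler_wpM2r ?(ltW K0)// ler_nat.
Qed.
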